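(* Let $X$ be a continuous dart (i.e., with no point masses) taking values in $\mathbb{R}$, with characteristic function $\phi_X(t)=Ee^{itX}$. If $\phi_X(t)$ does not go to zero as $t\to\infty$, then $(X,\cos(x))$ is not reasonable.
   Context: A dart is a random variable $X$ taking values in $\mathbb{R}$; it has no point masses if $P(X=x)=0$ for every $x\in\mathbb{R}$. A payoff function is a measurable function $f:\mathbb{R}\to\mathbb{R}$ bounded from above. For $d>0$, $g_{X,f}(d):=\sup_{a\in\mathbb{R}}Ef(a+dX)$. The pair $(X,f)$ is reasonable if $g_{X,f}(d)$ is decreasing (i.e. non-increasing) in $d\in(0,\infty)$. Here $(X,\cos(x))$ means $f(x)=\cos(x)$. *)

(* Defs.v *)
From HB Require Import structures.
From mathcomp Require Import all_boot all_order all_algebra.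
From mathcomp Require Import all_classical all_reals all_analysis measurable_realfun.
From mathcomp Require Import complex.

Set Implicit Arguments.
Unset Strict Implicit.
Unset Printing Implicit Defensive.

Import Order.TTheory GRing.Theory Num.Theory.
Import numFieldNormedType.Exports.

Local Open Scope classical_set_scope.
Local Open Scope ring_scope.
Local Open Scope complex_scope.

Definition no_point_mass {disp : measure_display} {T : measurableType disp}
    {R : realType} (P : probability T R) (X : {RV P >-> R}) : Prop :=
  forall x : R, P (X @^-1` [set x]) = 0%E.

Record payoff (R : realType) := Payoff {
  payoff_fun :> R -> R;
  payoff_measurable : measurable_fun [set: R] payoff_fun;
  payoff_bounded : exists M : R, forall x : R, payoff_fun x <= M }.

(* Values are extended reals: a payoff is only bounded from above, so its
   expectation may be -oo. *)
Definition best_payoff {disp : measure_display} {T : measurableType disp}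
    {R : realType} (P : probability T R) (X : {RV P >-> R}) (f : payoff R)
    (d : R) : \bar R :=
  ereal_sup (range (fun a : R => 'E_P[fun w => f (a + d * X w)%R]%E)).

Definition reasonable {disp : measure_display} {T : measurableType disp}
    {R : realType} (P : probability T R) (X : {RV P >-> R}) (f : payoff R)
    : Prop :=
  forall d1 d2 : R, 0 < d1 -> d1 <= d2 ->
    (best_payoff X f d2 <= best_payoff X f d1)%E.

Lemma measurable_cos (R : realType) :
  measurable_fun [set: R] (cos : R -> R).
Proof. by apply: continuous_measurable_fun; exact: continuous_cos. Qed.

Lemma cos_bounded_above (R : realType) :
  exists M : R, forall x : R, cos x <= M.
Proof. by exists 1 => x; exact: cos_le1. Qed.

Definition cos_payoff (R : realType) : payoff R :=
  Payoff (@measurable_cos R) (@cos_bounded_above R).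

(* [fine] sends an infinite expectation to 0; this is harmless for bounded Z. *)
Definition complex_expectation {disp : measure_display}
    {T : measurableType disp} {R : realType} (P : probability T R)
    (Z : T -> R[i]) : R[i] :=
  fine ('E_P[fun w => complex.Re (Z w)])%E +i*
  fine ('E_P[fun w => complex.Im (Z w)])%E.

(* Euler's formula for the exponential of i x with x real. *)
Definition expi {R : realType} (x : R) : R[i] := cos x +i* sin x.

Definition char_fun {disp : measure_display} {T : measurableType disp}
    {R : realType} (P : probability T R) (X : {RV P >-> R}) (t : R) : R[i] :=
  complex_expectation P (fun w => expi (t * X w)).

(* Main.v *)
Require Import Defs.
From HB Require Import structures.
From mathcomp Require Import all_boot all_order all_algebra.
From mathcomp Require Import all_classical all_reals all_analysis.
From mathcomp Require Import complex ring lra measurable_realfun.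

Import Order.TTheory GRing.Theory Num.Theory.
Import numFieldNormedType.Exports.

Local Open Scope classical_set_scope.
Local Open Scope ring_scope.

(** Write phi for the characteristic function of X.  The best payoff of the
cosine at scale d is |phi d|: the expectation of cos (a + d X) is the real
part of e^(i a) phi d, and the best rotation a aligns it with the positive
real axis ([best_payoff_cos]).  Hence reasonableness says exactly that |phi|
is nonincreasing on the positive reals, and it remains to see that this
forces phi to tend to 0 when X has no atom.

The reason is a discrete form of Wiener's lemma ([cvg_mean_sqr_char]): the
Cesaro means of |phi 1|^2, ..., |phi (N+1)|^2 tend to 0.  If X' is an
independent copy of X, then |phi k|^2 is the expectation of cos (k (X - X')),
so the mean is the expectation of a normalised Dirichlet kernel evaluated at
X - X'.  That kernel is bounded by 1 and tends to 0 off the multiples of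
2 pi; since X has no atom, X - X' almost surely avoids this countable set, and
dominated convergence applies.  The two copies are handled by an iterated
integral over the same probability space: conditionally on X' = y the kernel
is a linear combination of cosines and sines of X, so that the iterated
integral is computed by linearity alone, without a product measure.

Finally, by monotonicity |phi (N+1)|^2 is at most the mean of the first N+1
squares, so it tends to 0, and so does |phi t| as t goes to infinity. *)

(** * The Dirichlet kernel, zeros of the sine, and angles *)

(** Each term 2 sin (x/2) cos (k x) is the difference of the values of sin at
(k + 1/2) x and (k - 1/2) x, so the sum telescopes. *)
Lemma telescope_sum_cos (R : realType) (x : R) n :
  2 * sin (x / 2) * (\sum_(k < n) cos (k.+1%:R * x)) =
  sin (n%:R * x + x / 2) - sin (x / 2).
Proof.
elim: n => [|n IH]; first by rewrite big_ord0 mulr0 mul0r add0r subrr.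
rewrite big_ord_recr /= mulrDr IH.
have -> : n%:R * x + x / 2 = n.+1%:R * x - x / 2 by rewrite -natr1; field.
by rewrite sinB [sin (_ + x / 2)]sinD; ring.
Qed.

(** The normalised Dirichlet kernel without its constant term: leaving out the
frequency 0 keeps every frequency positive, as the best payoff is only known to
be monotone at positive scales. *)
Definition cos_mean {R : realType} (N : nat) (x : R) : R :=
  N.+1%:R^-1 * \sum_(k < N.+1) cos (k.+1%:R * x).

Lemma cos_mean_le1 (R : realType) N (x : R) : `|cos_mean N x| <= 1.
Proof.
rewrite normrM (gtr0_norm (_ : 0 < N.+1%:R^-1)) ?invr_gt0// ler_pdivrMl// mulr1.
apply: (le_trans (ler_norm_sum _ _ _)).
apply: (@le_trans _ _ (\sum_(k < N.+1) 1)); last by rewrite sumr_const card_ord.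
by apply: ler_sum => k _; exact: cos_max.
Qed.

(** By telescoping, the absolute value of the kernel is at most
1 / ((N+1) |sin (x/2)|). *)
Lemma cvg_cos_mean (R : realType) (x : R) : sin (x / 2) != 0 ->
  cos_mean N x @[N --> \oo] --> (0 : R).
Proof.
move=> s0; apply/norm_cvg0P.
apply: (squeeze_cvgr (f := fun=> 0) (h := fun N => harmonic N * `|sin (x / 2)|^-1)).
- near=> N; rewrite normr_ge0/=.
  rewrite normrM (gtr0_norm (_ : 0 < N.+1%:R^-1)) ?invr_gt0// ler_pM2l ?invr_gt0//.
  rewrite -[leRHS]mul1r ler_pdivlMr ?normr_gt0//.
  rewrite -(@ler_pM2l _ 2)// mulr1.
  have -> (u v : R) : 2 * (`|u| * `|v|) = `|2 * v * u|.
    by rewrite !normrM (ger0_norm (_ : 0 <= 2))//; ring.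
  rewrite telescope_sum_cos (le_trans (ler_normB _ _))//.
  by rewrite [leRHS](_ : 2 = 1 + 1)// lerD// sin_max.
- exact: cvg_cst.
- rewrite -[X in _ --> X](mul0r `|sin (x / 2)|^-1).
  by apply: cvgM; [exact: cvg_harmonic|exact: cvg_cst].
Unshelve. all: by end_near. Qed.

(** Subtracting from |x| the largest multiple of pi below it leaves a zero of
sin in [0, pi[, which can only be 0.  The sign is kept apart so that the zeros are
indexed by nat, as countable unions of events are. *)
Lemma sin0_pi_multiple (R : realType) (x : R) : sin x = 0 -> exists n : nat,
  x = n%:R * pi \/ x = - (n%:R * pi).
Proof.
wlog x0 : x / 0 <= x => [H sx|].
  have [/H /(_ sx)//|/ltW] := leP 0 x.
  rewrite -oppr_ge0 => /H; rewrite sinN sx oppr0 => /(_ erefl)[n [] xn].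
    by exists n; right; rewrite -xn opprK.
  by exists n; left; apply: oppr_inj.
move=> sx; have p0 := pi_gt0 R.
pose n := Num.truncn (x / pi); exists n; left.
have /andP[n1 n2] : (n%:R <= x / pi < n.+1%:R).
  by apply: truncn_itv; rewrite divr_ge0// ltW.
rewrite ler_pdivlMr// in n1; rewrite ltr_pdivrMr// -natr1 in n2.
have sper : forall m (y : R), sin y = 0 -> sin (y - m%:R * pi) = 0.
  elim=> [|m IH] y sy; first by rewrite mul0r subr0.
  have := IH _ sy.
  rewrite (_ : y - m%:R * pi = y - m.+1%:R * pi + pi); last by rewrite -natr1; ring.
  by rewrite sinDpi => /eqP; rewrite oppr_eq0 => /eqP.
have [xn|xn] := eqVneq (x - n%:R * pi) 0; first by apply/subr0_eq.
have := sper n x sx.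
suff : 0 < sin (x - n%:R * pi) by move=> /[swap] ->; rewrite ltxx.
apply: sin_gt0_pi; rewrite lt_neqAle eq_sym xn /= subr_ge0 n1/=; lra.
Qed.

(** The arc cosine of u has sine |v|; changing its sign corrects the sign of the
sine. *)
Lemma exists_angle (R : realType) (u v : R) : u ^+ 2 + v ^+ 2 = 1 ->
  exists a : R, cos a = u /\ sin a = v.
Proof.
move=> uv.
have u1 : -1 <= u <= 1.
  by rewrite -ler_norml -(@ler_pXn2r _ 2)// ?nnegrE// real_normK ?num_real//
    expr1n -uv lerDl sqr_ge0.
have sa : sin (acos u) = `|v|.
  by rewrite sin_acos// -uv [_ + v ^+ 2]addrC addrK sqrtr_sqr.
have [v0|v0] := leP 0 v.
  by exists (acos u); rewrite acosK ?sa ?ger0_norm.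
by exists (- acos u); rewrite cosN sinN acosK ?sa ?ltr0_norm ?opprK.
Qed.

(** * Integrals of functions bounded by 1 *)

Section Expectations.
Context {disp : measure_display} {T : measurableType disp} {R : realType}
  (P : probability T R).

Lemma integrable_scale (f : T -> R) a : P.-integrable setT (EFin \o f) ->
  P.-integrable setT (EFin \o (fun w => a * f w)).
Proof. exact: integrableZl. Qed.

Lemma integrable_norm_le1 (f : T -> R) : measurable_fun setT f ->
  (forall w, `|f w| <= 1) -> P.-integrable setT (EFin \o f).
Proof.
move=> mf f1; apply: measurable_bounded_integrable => //.
  by rewrite (le_lt_trans (probability_le1 P measurableT))// ltry.
by exists 1; split=> // x x1 w _; exact: le_trans (f1 w) (ltW x1).
Qed.

(** Dominated convergence with the constant 1 as dominating function, which is
integrable on a probability space. *)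
Lemma cvg_Rintegral_norm_le1 (f_ : nat -> T -> R) :
  (forall n, measurable_fun setT (f_ n)) -> (forall n w, `|f_ n w| <= 1) ->
  {ae P, forall w, f_ n w @[n --> \oo] --> (0 : R)} ->
  (\int[P]_w f_ n w) @[n --> \oo] --> (0 : R).
Proof.
move=> mf f1 f0.
have mEf n : measurable_fun setT (fun w => (f_ n w)%:E).
  exact/measurable_EFinP.
have Ef0 : {ae P, forall w, setT w -> (f_ n w)%:E @[n --> \oo] --> 0%:E}.
  by apply: filterS f0 => w fw _; apply: cvg_EFin => //; exact: nearW.
have i1 : P.-integrable setT (cst 1%:E).
  by apply: (@integrable_norm_le1 (cst 1)) => // w; rewrite normr1.
have Ef1 : {ae P, forall w n, setT w -> (`|(f_ n w)%:E| <= cst 1%:E w)%E}.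
  by apply/aeW => w n _; rewrite lee_fin.
have [_ _] := dominated_convergence measurableT mEf (measurable_cst _) Ef0 i1 Ef1.
by rewrite integral0; exact: fine_cvg.
Qed.

Lemma integrable_sum_norm_le1 n (h : nat -> T -> R) :
  (forall k, measurable_fun setT (h k)) -> (forall k w, `|h k w| <= 1) ->
  P.-integrable setT (EFin \o (fun w => \sum_(k < n) h k w)).
Proof.
move=> mh h1.
rewrite (_ : _ \o _ = fun w => (\sum_(k < n) (h k w)%:E)%E); last first.
  by apply/funext => w; rewrite /= sumEFin.
by apply: integrable_sum => // k _; exact: integrable_norm_le1.
Qed.

Lemma Rintegral_sum_norm_le1 n (h : nat -> T -> R) :
  (forall k, measurable_fun setT (h k)) -> (forall k w, `|h k w| <= 1) ->
  \int[P]_w (\sum_(k < n) h k w) = \sum_(k < n) \int[P]_w h k w.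
Proof.
move=> mh h1; elim: n => [|n IH].
  by under eq_Rintegral do rewrite big_ord0; rewrite big_ord0 Rintegral_cst// mul0r.
under eq_Rintegral do rewrite big_ord_recr /=.
rewrite RintegralD//.
- by rewrite IH big_ord_recr.
- exact: integrable_sum_norm_le1.
- exact: integrable_norm_le1.
Qed.

Lemma norm_Rintegral_le1 (f : T -> R) : measurable_fun setT f ->
  (forall w, `|f w| <= 1) -> `|\int[P]_w f w| <= 1.
Proof.
move=> mf f1.
have fi := integrable_norm_le1 f mf f1.
rewrite (le_trans (le_normr_Rintegral measurableT fi))//.
rewrite (le_trans (le_Rintegral measurableT _ _ (fun w _ => f1 w)))//.
- apply: integrable_norm_le1; first exact: measurableT_comp.
  by move=> w; rewrite normr_id.
- by apply: (integrable_norm_le1 (cst 1)) => // w; rewrite normr1.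
- rewrite Rintegral_cst// mul1r -lee_fin fineK; first exact: probability_le1.
  exact: fin_num_measure.
Qed.

(** * Wiener's lemma *)

Context (X : {RV P >-> R}).

Definition cos_transform (t : R) : R := \int[P]_w cos (t * X w).
Definition sin_transform (t : R) : R := \int[P]_w sin (t * X w).
Definition sqr_char (t : R) : R := cos_transform t ^+ 2 + sin_transform t ^+ 2.

Lemma measurable_comp_cos d' (T' : measurableType d') (f : T' -> R) :
  measurable_fun setT f -> measurable_fun setT (fun w => cos (f w)).
Proof. by move=> mf; apply: measurableT_comp => //; exact: measurable_cos. Qed.

Lemma measurable_comp_sin d' (T' : measurableType d') (f : T' -> R) :
  measurable_fun setT f -> measurable_fun setT (fun w => sin (f w)).
Proof.
move=> mf; apply: measurableT_comp => //.
by apply: continuous_measurable_fun; exact: continuous_sin.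
Qed.

Lemma measurable_scale t : measurable_fun setT (fun w => t * X w).
Proof. exact: measurable_funM. Qed.

Lemma integrable_cos t : P.-integrable setT (EFin \o (fun w => cos (t * X w))).
Proof.
apply: integrable_norm_le1 => [|w]; last exact: cos_max.
exact/measurable_comp_cos/measurable_scale.
Qed.

Lemma integrable_sin t : P.-integrable setT (EFin \o (fun w => sin (t * X w))).
Proof.
apply: integrable_norm_le1 => [|w]; last exact: sin_max.
exact/measurable_comp_sin/measurable_scale.
Qed.

(** The real part of the identity E e^(i (t X - s)) = e^(- i s) E e^(i t X). *)
Lemma Rintegral_cosB t s : \int[P]_w cos (t * X w - s) =
  cos s * cos_transform t + sin s * sin_transform t.
Proof.
under eq_Rintegral do rewrite cosB [_ * cos s]mulrC [_ * sin s]mulrC.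
have ic := integrable_cos t; have isn := integrable_sin t.
by rewrite RintegralD ?RintegralZl//; exact: integrable_scale.
Qed.

Lemma measurable_cos_mean d' (T' : measurableType d') N (f : T' -> R) :
  measurable_fun setT f -> measurable_fun setT (fun w => cos_mean N (f w)).
Proof.
move=> mf; apply: measurable_funM => //; apply: measurable_sum => k.
by apply: measurable_comp_cos; exact: measurable_funM.
Qed.

Lemma Rintegral_cos_mean N y : \int[P]_w cos_mean N (X w - y) =
  N.+1%:R^-1 * \sum_(k < N.+1) (cos (k.+1%:R * y) * cos_transform k.+1%:R +
                                sin (k.+1%:R * y) * sin_transform k.+1%:R).
Proof.
have mk k : measurable_fun setT (fun w => cos (k.+1%:R * (X w - y))).
  by apply: measurable_comp_cos; apply: measurable_funM => //; exact: measurable_funB.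
have ck k w : `|cos (k.+1%:R * (X w - y))| <= 1 by exact: cos_max.
rewrite RintegralZl//; last exact: integrable_sum_norm_le1 mk ck.
rewrite (Rintegral_sum_norm_le1 _ (fun k w => cos (k.+1%:R * (X w - y))))//.
congr (_ * _); apply: eq_bigr => k _; rewrite -Rintegral_cosB.
by under eq_Rintegral do rewrite mulrBr.
Qed.

(** Integrating the cosine of k (X - y) in X gives a
combination of cos (k y) and sin (k y), whose integral at y = X is the sum of
the squares of the real and imaginary parts of the characteristic function. *)
Lemma Rintegral2_cos_mean N :
  \int[P]_v \int[P]_w cos_mean N (X w - X v) =
  N.+1%:R^-1 * \sum_(k < N.+1) sqr_char k.+1%:R.
Proof.
under eq_Rintegral do rewrite Rintegral_cos_mean.
pose h k v := cos (k.+1%:R * X v) * cos_transform k.+1%:R +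
              sin (k.+1%:R * X v) * sin_transform k.+1%:R.
have mh k : measurable_fun setT (h k).
  by apply: measurable_funD; apply: measurable_funM => //;
    [apply: measurable_comp_cos|apply: measurable_comp_sin]; exact: measurable_scale.
have h1 k v : `|h k v| <= 1.
  rewrite /h -Rintegral_cosB norm_Rintegral_le1// => [|w]; last exact: cos_max.
  by apply: measurable_comp_cos; apply: measurable_funB => //; exact: measurable_scale.
rewrite RintegralZl//; last exact: integrable_sum_norm_le1 mh h1.
rewrite (Rintegral_sum_norm_le1 _ h)//.
congr (_ * _); apply: eq_bigr => k _; rewrite /h.
under eq_Rintegral do rewrite [cos _ * _]mulrC [sin _ * _]mulrC.
have ic := integrable_cos k.+1%:R; have isn := integrable_sin k.+1%:R.
by rewrite RintegralD ?RintegralZl//; exact: integrable_scale.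
Qed.

(** The exceptional event is a countable union of events X = x. *)
Lemma ae_sin_neq0 y : no_point_mass X -> {ae P, forall w, sin ((X w - y) / 2) != 0}.
Proof.
move=> X0.
have n0 x : P.-negligible (X @^-1` [set x]).
  apply/negligibleP; last exact: X0.
  by rewrite -[_ @^-1` _]setTI; exact: measurable_funPT.
apply: (@negligibleS _ _ _ _ (\bigcup_n (X @^-1` [set y + 2 * (n%:R * pi)] `|`
   X @^-1` [set y - 2 * (n%:R * pi)]))); last first.
  by apply: negligible_bigcup => n; exact: negligibleU.
move=> w /= /negP; rewrite negbK => /eqP /sin0_pi_multiple[n nE].
by exists n => //; case: nE => nE; [left|right] => /=; lra.
Qed.

(** Wiener's lemma for an atomless law: the means are iterated integrals of the
kernel at X - X', and dominated convergence applies first to the inner and then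
to the outer integral. *)
Lemma cvg_mean_sqr_char : no_point_mass X ->
  (N.+1%:R^-1 * \sum_(k < N.+1) sqr_char k.+1%:R) @[N --> \oo] --> (0 : R).
Proof.
move=> X0; under eq_cvg do rewrite -Rintegral2_cos_mean.
have mX y N : measurable_fun setT (fun w => cos_mean N (X w - y)).
  by apply: measurable_cos_mean; exact: measurable_funB.
apply: cvg_Rintegral_norm_le1.
- move=> N; under eq_fun do rewrite Rintegral_cos_mean.
  apply: measurable_funM => //; apply: measurable_sum => k.
  by apply: measurable_funD; apply: measurable_funM => //;
    [apply: measurable_comp_cos|apply: measurable_comp_sin]; exact: measurable_scale.
- move=> N v; apply: norm_Rintegral_le1 => // w; exact: cos_mean_le1.
- apply/aeW => v; apply: cvg_Rintegral_norm_le1 => //.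
  + by move=> N w; exact: cos_mean_le1.
  + by apply: filterS (ae_sin_neq0 (X v) X0) => w; exact: cvg_cos_mean.
Qed.

(** * The best payoff of the cosine *)

(** The upper bound is the Cauchy-Schwarz inequality for (cos a, - sin a) and
the pair (C, S) of real and imaginary parts; it is attained when the two vectors
are parallel. *)
Lemma best_payoff_cos d : best_payoff X (cos_payoff R) d = (Num.sqrt (sqr_char d))%:E.
Proof.
set C := cos_transform d; set S := sin_transform d.
have E a : ('E_P[fun w => cos (a + d * X w)%R])%E = (cos a * C - sin a * S)%:E.
  have -> : cos a * C - sin a * S = \int[P]_w cos (d * X w - - a).
    by rewrite Rintegral_cosB cosN sinN mulNr.
  rewrite unlock /Rintegral fineK; last first.
    apply: integrable_fin_num => //.
    apply: integrable_norm_le1 => [|w]; last exact: cos_max.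
    by apply: measurable_comp_cos; apply: measurable_funB => //; exact: measurable_scale.
  by under [RHS]eq_integral do rewrite opprK addrC.
have s0 : 0 <= sqr_char d by rewrite addr_ge0// sqr_ge0.
apply/eqP; rewrite eq_le; apply/andP; split.
  apply: ge_ereal_sup => _ [a _ <-]; rewrite /= E lee_fin.
  rewrite (le_trans (ler_norm _))// -sqrtr_sqr ler_sqrt//.
  (* Lagrange's identity: the defect is the square of the cross product. *)
  rewrite -subr_ge0 (_ : _ - _ = (sin a * C + cos a * S) ^+ 2) ?sqr_ge0//.
  rewrite /sqr_char -/C -/S -[C ^+ 2 + S ^+ 2]mul1r -(cos2Dsin2 a).
  by ring.
(* The maximising angle is undefined when C = S = 0; any angle then works. *)
have [r0|r0] := eqVneq (sqr_char d) 0.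
  rewrite r0 sqrtr0; apply: (@le_trans _ _ (cos 0 * C - sin 0 * S)%:E).
    move/eqP: r0; rewrite paddr_eq0 ?sqr_ge0// !sqrf_eq0 => /andP[/eqP c0 /eqP s0'].
    by rewrite /C /S c0 s0' !mulr0 subrr.
  by rewrite -E; apply: ereal_sup_ubound; exists 0.
set r := Num.sqrt _.
have r2 : r ^+ 2 = C ^+ 2 + S ^+ 2 by rewrite sqr_sqrtr.
have rn : r != 0 by rewrite sqrtr_eq0 -ltNge lt_neqAle eq_sym r0.
have [|a [ca sa]] := @exists_angle R (C / r) (- S / r).
  by rewrite !exprMn sqrrN -mulrDl -r2 -exprMn divff// expr1n.
have -> : r = cos a * C - sin a * S.
  by rewrite ca sa; apply: (mulfI rn); rewrite -expr2 r2; field.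
by rewrite -E; apply: ereal_sup_ubound; exists a.
Qed.

Lemma char_funE t : char_fun X t = (cos_transform t +i* sin_transform t)%C.
Proof. by rewrite /char_fun /complex_expectation !unlock. Qed.

End Expectations.

(** * A reasonable atomless dart has a vanishing characteristic function *)

Theorem proposition1p12 (disp : measure_display) (T : measurableType disp)
    (R : realType) (P : probability T R) (X : {RV P >-> R}) :
  no_point_mass X ->
  ~ ((char_fun X t : R[i]^o) @[t --> +oo] --> (0 : R[i]^o)) ->
  ~ reasonable X (cos_payoff R).
Proof.
move=> X0 nphi reas; apply: nphi.
have s0 t : 0 <= sqr_char P X t by rewrite addr_ge0// sqr_ge0.
have dec t1 t2 : 0 < t1 -> t1 <= t2 -> sqr_char P X t2 <= sqr_char P X t1.
  move=> t10 t12; have := reas t1 t2 t10 t12.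
  by rewrite !best_payoff_cos lee_fin ler_sqrt.
have sle N : sqr_char P X N.+1%:R <=
    N.+1%:R^-1 * \sum_(k < N.+1) sqr_char P X k.+1%:R.
  rewrite ler_pdivlMl// mulr_natl.
  have -> : sqr_char P X N.+1%:R *+ N.+1 = \sum_(k < N.+1) sqr_char P X N.+1%:R.
    by rewrite sumr_const card_ord.
  by apply: ler_sum => k _; apply: dec; rewrite ?ltr0n// ler_nat ltn_ord.
(* A positive element of R[i] is real, so the estimate takes place in R. *)
apply/cvgr0Pnorm_lt => e e0.
have [e' e'0 eE] : exists2 e' : R, 0 < e' & e = (e'%:C)%C.
  case: e e0 => a b; rewrite ltcE /= => /andP[/eqP -> a0].
  by exists a.
have e20 : 0 < e' ^+ 2 by rewrite exprn_gt0.
have [N _ /(_ N (leqnn N)) NP] := (cvgr0Pnorm_lt _).1 (cvg_mean_sqr_char P X X0) _ e20.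
near=> t.
rewrite eE normc_def ltcR -(ger0_norm (ltW e'0)) -sqrtr_sqr ltr_sqrt//.
rewrite char_funE /=; apply: (@le_lt_trans _ _ (sqr_char P X N.+1%:R)).
  by apply: dec => //; near: t; exact: nbhs_pinfty_ge.
by apply: le_lt_trans NP; rewrite (le_trans (sle N))// ler_norm.
Unshelve. all: by end_near. Qed.
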